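(* Let $d\ge1$, let $\mathbb{S}_d$ be the unit sphere of $\mathbb{C}^d$ and $\mathbb{T}$ the unit circle. The weak-$*$ exposed points of the closed unit ball of the dual space $\mathrm{A}(\mathbb{B}_d)^*$ of the ball algebra are exactly the functionals $\lambda\delta_\zeta$, $f\mapsto \lambda f(\zeta)$, for $\zeta\in\mathbb{S}_d$ and $\lambda\in\mathbb{T}$.
   Context: $\mathrm{A}(\mathbb{B}_d)$ is the Banach algebra (supremum norm) of functions analytic on the open unit ball $\mathbb{B}_d\subset\mathbb{C}^d$ and continuous on its closure. For a weak-$*$ closed convex set $C$ in a dual Banach space $E^*$, a point $x_0\in C$ is a weak-$*$ exposed point if there is a weak-$*$ continuous functional (i.e. an element $e\in E$) with $\operatorname{Re} x(e) < \operatorname{Re} x_0(e)$ for all $x\in C\setminus\{x_0\}$. *)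

(* Defs.v *)
From HB Require Import structures.
From mathcomp Require Import all_boot all_order all_algebra.
From mathcomp Require Import complex.
From mathcomp Require Import boolp classical_sets reals.
Set Implicit Arguments. Unset Strict Implicit. Unset Printing Implicit Defensive.
Import Order.TTheory GRing.Theory Num.Theory.
Local Open Scope ring_scope.
Local Open Scope classical_set_scope.

Section BallAlgebra.
Variables (R : realType) (d : nat).

Definition cvec := 'I_d -> R[i].

Definition cabs (z : R[i]) : R := Normc.normc z.

Definition vnorm (z : cvec) : R := Num.sqrt (\sum_(i < d) cabs (z i) ^+ 2).

Definition vadd (z h : cvec) : cvec := fun i => z i + h i.
Definition vsub (z h : cvec) : cvec := fun i => z i - h i.

Definition open_ball : set cvec := [set z | vnorm z < 1].
Definition closed_ball : set cvec := [set z | vnorm z <= 1].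
Definition unit_sphere : set cvec := [set z | vnorm z = 1].

Definition holomorphic_on_ball (f : cvec -> R[i]) : Prop :=
  forall z, open_ball z ->
  exists a : cvec, forall eps : R, 0 < eps -> exists2 delta : R, 0 < delta &
    forall h : cvec, vnorm h < delta ->
      cabs (f (vadd z h) - f z - \sum_(i < d) a i * h i) <= eps * vnorm h.

Definition continuous_on_closed_ball (f : cvec -> R[i]) : Prop :=
  forall z, closed_ball z ->
  forall eps : R, 0 < eps -> exists2 delta : R, 0 < delta &
    forall w, closed_ball w -> vnorm (vsub w z) < delta ->
      cabs (f w - f z) < eps.

Definition ball_algebra (f : cvec -> R[i]) : Prop :=
  holomorphic_on_ball f /\ continuous_on_closed_ball f.

Definition supnorm (f : cvec -> R[i]) : R :=
  sup [set cabs (f z) | z in closed_ball].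

(* functionals; two functionals are identified when they agree on A(B_d) *)
Definition functional := (cvec -> R[i]) -> R[i].

Definition dual_unit_ball (phi : functional) : Prop :=
  (forall (a : R[i]) f g, ball_algebra f -> ball_algebra g ->
     phi (fun z => a * f z + g z) = a * phi f + phi g) /\
  (forall f, ball_algebra f -> cabs (phi f) <= supnorm f).

Definition same_on_algebra (phi psi : functional) : Prop :=
  forall f, ball_algebra f -> phi f = psi f.

Definition weak_star_exposed (phi : functional) : Prop :=
  dual_unit_ball phi /\
  exists e, ball_algebra e /\
    forall psi, dual_unit_ball psi -> ~ same_on_algebra psi phi ->
      complex.Re (psi e) < complex.Re (phi e).

End BallAlgebra.

(* Main.v *)
From HB Require Import structures.
From mathcomp Require Import all_boot all_order all_algebra.
From mathcomp Require Import complex.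
From mathcomp Require Import all_classical all_reals all_analysis.
From mathcomp Require Import ring lra.
Require Import Defs.
Set Implicit Arguments. Unset Strict Implicit. Unset Printing Implicit Defensive.
Import Order.TTheory GRing.Theory Num.Theory.
Import numFieldNormedType.Exports.
Local Open Scope ring_scope.
Local Open Scope classical_set_scope.

(**
  If [phi] is exposed by [e], then [phi e] has real part [||e||]. By compactness
  and the maximum modulus principle [||e||] is attained by [|e|] at some [zeta]
  on the sphere, so a suitable [lam * delta_zeta] does at least as well as [phi]
  on [e] and must coincide with it.

  Conversely, [lam * delta_zeta] is exposed by [lam^* g] with
  [g z = (1 + <z, zeta>) / 2], which satisfies
  [|g z| <= 1 - |z - zeta|^2 / 8]. A functional [psi] of norm at most one with
  [psi (lam^* g) = 1] kills every [h] vanishing at [zeta], because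
  [||lam^* g + t h|| <= 1 + o(t)].

  The maximum modulus principle comes from the mean value property. In polar
  coordinates [w = exp (x + i y)] the function [F] becomes [2 pi]-periodic in
  [y]; Goursat's bisection argument on the rectangle [[a, b] x [0, 2 pi]] shows
  that the circle averages of [Re F] do not depend on the radius, and they tend
  to [Re (F 0)] as the radius shrinks.
*)

(** * Integrals of continuous real functions over a segment *)

Section SegmentIntegral.
Context {R : realType}.
Implicit Types (g : R -> R) (a b m k : R).

(** Continuity is that of [g] as a function on the whole line, hence two-sided even at [a] and [b];
    differentiability at the boundary points of a rectangle supplies it. *)
Definition continuous_on_segment a b g :=
  forall x, a <= x <= b -> {for x, continuous g}.

Definition segment_integral a b g : R :=
  \int[@lebesgue_measure R]_(x in `[a, b]) g x.

Lemma segment_integrable a b g : continuous_on_segment a b g ->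
  (@lebesgue_measure R).-integrable `[a, b] (EFin \o g).
Proof.
move=> cg; apply: continuous_compact_integrable; first exact: segment_compact.
by apply: continuous_in_subspaceT => x; rewrite inE /= in_itv => /cg.
Qed.

Lemma segment_integral_split a m b g : a <= m -> m <= b ->
  continuous_on_segment a b g ->
  segment_integral a b g = segment_integral a m g + segment_integral m b g.
Proof.
move=> am mb cg.
have ig := segment_integrable cg.
(* [Rintegral_itvB] yields the half-open piece; adding the endpoint [m] does not change the
   integral. *)
have -> : segment_integral m b g =
    \int[@lebesgue_measure R]_(x in `]m, b]) g x.
  rewrite /segment_integral Rintegral_itv_obnd_cbnd //.
  apply: integrableS ig => //; apply: subset_itvr; by rewrite bnd_simp.
rewrite /segment_integral -(Rintegral_itvB ig) ?bnd_simp //.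
by rewrite addrC subrK.
Qed.

Lemma segment_integralB a b g h :
  continuous_on_segment a b g -> continuous_on_segment a b h ->
  segment_integral a b (fun x => g x - h x) =
  segment_integral a b g - segment_integral a b h.
Proof.
move=> cg ch; rewrite /segment_integral RintegralB //;
  exact: segment_integrable.
Qed.

Lemma segment_integral_cst a b k : a <= b ->
  segment_integral a b (fun=> k) = k * (b - a).
Proof.
move=> ab; rewrite /segment_integral Rintegral_cst //.
have E : @lebesgue_measure R `[a, b] = (if a < b then (b - a)%:E else 0%E).
  by rewrite lebesgue_measure_itv /= lte_fin; case: ifP => // _; rewrite EFinB.
congr (_ * _); apply: (etrans (congr1 fine E)).
by move: ab; rewrite le_eqVlt => /predU1P[->|->//]; rewrite ltxx subrr.
Qed.

Lemma continuous_on_segment_cst a b k : continuous_on_segment a b (fun=> k).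
Proof. by move=> x _; exact: cst_continuous. Qed.

Lemma le_segment_integral_cst a b g k : a <= b -> continuous_on_segment a b g ->
  (forall x, a <= x <= b -> g x <= k) -> segment_integral a b g <= k * (b - a).
Proof.
move=> ab cg gk; rewrite -segment_integral_cst //.
apply: le_Rintegral => //; apply: segment_integrable => //.
exact: continuous_on_segment_cst.
Qed.

Lemma ge_segment_integral_cst a b g k : a <= b -> continuous_on_segment a b g ->
  (forall x, a <= x <= b -> k <= g x) -> k * (b - a) <= segment_integral a b g.
Proof.
move=> ab cg gk; rewrite -segment_integral_cst //.
apply: le_Rintegral => //; apply: segment_integrable => //.
exact: continuous_on_segment_cst.
Qed.

Lemma segment_integral_near_cst a b g k e : a <= b ->
  continuous_on_segment a b g ->
  (forall x, a <= x <= b -> `|g x - k| <= e) ->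
  `|segment_integral a b g - k * (b - a)| <= e * (b - a).
Proof.
move=> ab cg gk.
have h1 : segment_integral a b g <= (k + e) * (b - a).
  apply: le_segment_integral_cst => // x /gk; rewrite ler_norml => /andP[_]; lra.
have h2 : (k - e) * (b - a) <= segment_integral a b g.
  apply: ge_segment_integral_cst => // x /gk; rewrite ler_norml => /andP[]; lra.
by rewrite ler_norml; apply/andP; split; lra.
Qed.

Lemma continuous_at_distP g x : {for x, continuous g} <->
  forall e, 0 < e -> exists2 del : R, 0 < del &
    forall y, `|y - x| < del -> `|g y - g x| < e.
Proof.
split.
  move=> /cvgrPdist_lt cg e e0.
  have /nbhs_ballP[del /= del0 h] := cg _ e0.
  by exists del => // y yx; rewrite distrC; apply: h; rewrite /ball /= distrC.
move=> h; apply/cvgrPdist_lt => e e0.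
have [del del0 hd] := h _ e0.
apply/nbhs_ballP; exists del => //= y; rewrite /ball /= => yx.
by rewrite distrC hd // distrC.
Qed.

(** A positive value at [a] would keep [g] above [g a / 2] on a short segment to the right of [a],
    and the rest contributes at least 0. Only the left endpoint is treated because it will be the
    angle 0 of a circle. *)
Lemma segment_integral_eq0 a b g : a < b -> continuous_on_segment a b g ->
  (forall x, a <= x <= b -> 0 <= g x) -> segment_integral a b g <= 0 ->
  g a = 0.
Proof.
move=> ab cg g0 I0.
have haa : a <= a <= b by rewrite lexx ltW.
apply/eqP; rewrite eq_le (g0 _ haa) andbT leNgt; apply/negP => ga.
have /continuous_at_distP/(_ (g a / 2)) := cg a haa.
rewrite divr_gt0 // => /(_ isT)[del del0 hd].
pose m := Num.min (a + del / 2) b.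
have am : a < m by rewrite lt_min ab andbT; lra.
have mb : m <= b by rewrite ge_min lexx orbT.
have md : m <= a + del / 2 by rewrite ge_min lexx.
have cam : continuous_on_segment a m g.
  by move=> x /andP[x1 x2]; apply: cg; rewrite x1 (le_trans x2).
have cmb : continuous_on_segment m b g.
  by move=> x /andP[x1 x2]; apply: cg; rewrite x2 (le_trans (ltW am)).
have := segment_integral_split (ltW am) mb cg.
have h1 : (g a / 2) * (m - a) <= segment_integral a m g.
  apply: ge_segment_integral_cst => //; first exact: ltW.
  move=> x /andP[x1 x2].
  have /hd : `|x - a| < del by rewrite ger0_norm ?subr_ge0 //; lra.
  rewrite ltr_norml => /andP[]; lra.
have h2 : 0 * (b - m) <= segment_integral m b g.
  apply: ge_segment_integral_cst => // x /andP[x1 x2]; apply: g0.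
  by rewrite x2 (le_trans (ltW am)).
have h3 : 0 < (g a / 2) * (m - a) by rewrite mulr_gt0 ?divr_gt0 ?subr_gt0.
move: h2; rewrite mul0r; lra.
Qed.

End SegmentIntegral.

(** * Goursat's theorem on rectangles *)

Section Goursat.
Context {R : realType}.
Implicit Types (u v : R -> R -> R) (a b c d m x y e : R).

(* Total differentiability of [(u, v)] with [u_x = v_y], half of the
   Cauchy-Riemann equations. *)
Definition cr_differentiable u v x y :=
  exists al be ga : R, forall e, 0 < e -> exists2 del : R, 0 < del &
    forall h k, `|h| < del -> `|k| < del ->
      `|u (x + h) (y + k) - u x y - (al * h + be * k)| <= e * (`|h| + `|k|) /\
      `|v (x + h) (y + k) - v x y - (ga * h + al * k)| <= e * (`|h| + `|k|).

(** A linear approximation with error at most [|h|] already gives the bound [(|al| + 1) * |h|] on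
    the increment of [g]. *)
Lemma continuous_lin_approx (g : R -> R) (x al : R) :
  (exists2 del : R, 0 < del & forall h, `|h| < del ->
     `|g (x + h) - g x - al * h| <= `|h|) ->
  {for x, continuous g}.
Proof.
case=> del del0 hg; apply/continuous_at_distP => e e0.
have K0 : 0 < `|al| + 1 by rewrite ltr_wpDl.
exists (Num.min del (e / (`|al| + 1))).
  by rewrite lt_min del0 divr_gt0.
move=> y; rewrite lt_min => /andP[y1 y2].
have := hg _ y1; rewrite [x + _]addrC subrK => h1.
rewrite ltr_pdivlMr // mulrC mulrDl mul1r -normrM in y2.
apply: le_lt_trans y2; rewrite -[g y - g x](subrK (al * (y - x))) addrC.
by rewrite (le_trans (ler_normD _ _)) // lerD2l.
Qed.

Lemma cr_continuous u v x y : cr_differentiable u v x y ->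
  [/\ {for x, continuous (u^~ y)}, {for y, continuous (u x)},
      {for x, continuous (v^~ y)} & {for y, continuous (v x)}].
Proof.
case=> al [be [ga /(_ 1 ltr01)[del del0 h]]].
have n0 : `|0 : R| < del by rewrite normr0.
split.
- apply: (@continuous_lin_approx _ x al); exists del => // k k1.
  by have [+ _] := h _ _ k1 n0; rewrite addr0 mulr0 addr0 normr0 addr0 mul1r.
- apply: (@continuous_lin_approx _ y be); exists del => // k k1.
  by have [+ _] := h _ _ n0 k1; rewrite addr0 mulr0 add0r normr0 add0r mul1r.
- apply: (@continuous_lin_approx _ x ga); exists del => // k k1.
  by have [_] := h _ _ k1 n0; rewrite addr0 mulr0 addr0 normr0 addr0 mul1r.
- apply: (@continuous_lin_approx _ y al); exists del => // k k1.
  by have [_] := h _ _ n0 k1; rewrite addr0 mulr0 add0r normr0 add0r mul1r.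
Qed.

(** This is the integral of [u dy + v dx] along the boundary of [[a, b] x [c, d]], that is, the
    imaginary part of the contour integral of [u + i v]. By Green's formula it corresponds to the
    double integral of [u_x - v_y]. *)
Definition flux u v a b c d : R :=
  segment_integral c d (fun y => u b y - u a y) -
  segment_integral a b (fun x => v x d - v x c).

Definition cr_on u v a b c d := forall x y, a <= x <= b -> c <= y <= d ->
  cr_differentiable u v x y.

Lemma cr_on_sub u v a b c d a' b' c' d' : a <= a' -> b' <= b -> c <= c' ->
  d' <= d -> cr_on u v a b c d -> cr_on u v a' b' c' d'.
Proof.
move=> aa bb cc dd h x y /andP[x1 x2] /andP[y1 y2]; apply: h.
  by rewrite (le_trans aa x1) (le_trans x2 bb).
by rewrite (le_trans cc y1) (le_trans y2 dd).
Qed.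

Lemma cr_on_ux u v a b c d x : cr_on u v a b c d -> a <= x <= b ->
  continuous_on_segment c d (u x).
Proof. by move=> h hx y hy; have [] := cr_continuous (h _ _ hx hy). Qed.

Lemma cr_on_vy u v a b c d y : cr_on u v a b c d -> c <= y <= d ->
  continuous_on_segment a b (v^~ y).
Proof. by move=> h hy x hx; have [] := cr_continuous (h _ _ hx hy). Qed.

Lemma continuous_on_segmentB a b (f g : R -> R) :
  continuous_on_segment a b f -> continuous_on_segment a b g ->
  continuous_on_segment a b (fun x => f x - g x).
Proof.
by move=> cf cg x hx; apply: continuousB; [exact: cf|exact: cg].
Qed.

Lemma flux_split_x u v a b c d m : a <= m -> m <= b -> c <= d ->
  cr_on u v a b c d ->
  flux u v a b c d = flux u v a m c d + flux u v m b c d.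
Proof.
move=> am mb cd h.
have ab := le_trans am mb.
have ca : continuous_on_segment c d (u a) by apply: (cr_on_ux h); rewrite lexx.
have cb : continuous_on_segment c d (u b) by apply: (cr_on_ux h); rewrite lexx ab.
have cm : continuous_on_segment c d (u m) by apply: (cr_on_ux h); rewrite am.
have cv : continuous_on_segment a b (fun x => v x d - v x c).
  by apply: continuous_on_segmentB; apply: (cr_on_vy h); rewrite lexx ?cd.
rewrite /flux (segment_integral_split am mb cv).
rewrite (segment_integralB cb ca) (segment_integralB cm ca) (segment_integralB cb cm).
ring.
Qed.

Lemma flux_split_y u v a b c d m : c <= m -> m <= d -> a <= b ->
  cr_on u v a b c d ->
  flux u v a b c d = flux u v a b c m + flux u v a b m d.
Proof.
move=> cm md ab h.
have cd := le_trans cm md.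
have vc : continuous_on_segment a b (v^~ c) by apply: (cr_on_vy h); rewrite lexx.
have vd : continuous_on_segment a b (v^~ d) by apply: (cr_on_vy h); rewrite lexx cd.
have vm : continuous_on_segment a b (v^~ m) by apply: (cr_on_vy h); rewrite cm.
have cu : continuous_on_segment c d (fun y => u b y - u a y).
  by apply: continuous_on_segmentB; apply: (cr_on_ux h); rewrite lexx ?ab.
rewrite /flux (segment_integral_split cm md cu).
rewrite (segment_integralB vd vc) (segment_integralB vm vc) (segment_integralB vd vm).
ring.
Qed.

(** The flux is additive under bisection in both directions, so by the triangle inequality one of
    the four quarters carries at least a quarter of it. Quarters are recorded by their lower left
    corner, their common sides being [w] and [l]. *)
Lemma flux_quarter u v a b c d : a <= b -> c <= d -> cr_on u v a b c d ->
  let w := (b - a) / 2 in let l := (d - c) / 2 in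
  exists a' c', [/\ a' = a \/ a' = a + w, c' = c \/ c' = c + l &
    `|flux u v a b c d| / 4 <= `|flux u v a' (a' + w) c' (c' + l)|].
Proof.
move=> ab cd h w l.
have aw : a <= a + w by rewrite /w; lra.
have wb : a + w <= b by rewrite /w; lra.
have cl : c <= c + l by rewrite /l; lra.
have ld : c + l <= d by rewrite /l; lra.
have eb : a + w + w = b by rewrite /w; field.
have ed : c + l + l = d by rewrite /l; field.
have E : flux u v a b c d =
  flux u v a (a + w) c (c + l) + flux u v a (a + w) (c + l) d +
  (flux u v (a + w) b c (c + l) + flux u v (a + w) b (c + l) d).
  rewrite (flux_split_x aw wb cd h).
  by congr (_ + _); apply: flux_split_y => //; apply: cr_on_sub h.
move: E; set J := flux u v a b c d; set J1 := flux _ _ _ _ _ _.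
set J2 := flux _ _ _ _ _ _; set J3 := flux _ _ _ _ _ _.
set J4 := flux _ _ _ _ _ _ => E.
have [h1|h1] := leP (`|J| / 4) `|J1|.
  by exists a, c; split; [left|left|].
have [h2|h2] := leP (`|J| / 4) `|J2|.
  by exists a, (c + l); split; [left|right|rewrite ed].
have [h3|h3] := leP (`|J| / 4) `|J3|.
  by exists (a + w), c; split; [right|left|rewrite eb].
have [h4|h4] := leP (`|J| / 4) `|J4|.
  by exists (a + w), (c + l); split; [right|right|rewrite eb ed].
have : `|J| <= `|J1| + `|J2| + (`|J3| + `|J4|).
  by rewrite E (le_trans (ler_normD _ _)) // lerD // ler_normD.
move: h1 h2 h3 h4; lra.
Qed.

(** The affine part of [(u, v)] at [(x, y)] contributes [al * (b - a) * (d - c)] to both integrals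
    of the flux, and these cancel since [u_x = v_y = al]. What remains is an error proportional to
    the size of the rectangle, integrated along its sides. *)
Lemma flux_local u v x y e : cr_differentiable u v x y -> 0 < e ->
  exists2 del : R, 0 < del & forall a b c d, a <= x <= b -> c <= y <= d ->
    b - a < del -> d - c < del -> cr_on u v a b c d ->
    `|flux u v a b c d| <= e * (b - a + (d - c)) ^+ 2.
Proof.
move=> [al [be [ga h]]] e0.
have e2 : 0 < e / 2 by rewrite divr_gt0.
have [del del0 hd] := h _ e2; exists del => // a b c d.
move=> /andP[ax xb] /andP[cy yd] wd ld cr.
have ab := le_trans ax xb; have cd := le_trans cy yd.
set s := b - a + (d - c).
have near p q : a <= p <= b -> c <= q <= d ->
    [/\ `|p - x| < del, `|q - y| < del & `|p - x| + `|q - y| <= s].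
  move=> /andP[p1 p2] /andP[q1 q2].
  have np : `|p - x| <= b - a by rewrite ler_norml; apply/andP; split; lra.
  have nq : `|q - y| <= d - c by rewrite ler_norml; apply/andP; split; lra.
  by split; [exact: le_lt_trans np _|exact: le_lt_trans nq _|exact: lerD].
have est p q : a <= p <= b -> c <= q <= d ->
    `|u p q - u x y - (al * (p - x) + be * (q - y))| <= e / 2 * s /\
    `|v p q - v x y - (ga * (p - x) + al * (q - y))| <= e / 2 * s.
  move=> hp hq; have [n1 n2 n3] := near _ _ hp hq.
  have := hd _ _ n1 n2; rewrite [x + _]addrC [y + _]addrC !subrK => -[h1 h2].
  by split; [apply: le_trans h1 _|apply: le_trans h2 _];
    rewrite ler_pM2l.
have ha : a <= a <= b by rewrite lexx.
have hb : a <= b <= b by rewrite lexx ab.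
have hc : c <= c <= d by rewrite lexx.
have hd' : c <= d <= d by rewrite lexx cd.
(* In [u b y - u a y] the terms in [be] cancel, and the two errors [e / 2 * s] add up to [e * s].
   The other integral is symmetric, with [ga] cancelling. *)
have h1 : `|segment_integral c d (fun y => u b y - u a y) - al * (b - a) * (d - c)|
    <= e * s * (d - c).
  apply: segment_integral_near_cst => //.
    by apply: continuous_on_segmentB; exact: (cr_on_ux cr).
  move=> q hq; have [+ _] := est _ _ hb hq; have [+ _] := est _ _ ha hq.
  rewrite !ler_norml => /andP[? ?] /andP[? ?]; apply/andP; split; lra.
have h2 : `|segment_integral a b (fun x => v x d - v x c) - al * (d - c) * (b - a)|
    <= e * s * (b - a).
  apply: segment_integral_near_cst => //.
    by apply: continuous_on_segmentB; exact: (cr_on_vy cr).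
  move=> p hp; have [_] := est _ _ hp hd'; have [_] := est _ _ hp hc.
  rewrite !ler_norml => /andP[? ?] /andP[? ?]; apply/andP; split; lra.
rewrite /flux; move: h1 h2.
set I1 := segment_integral _ _ _; set I2 := segment_integral _ _ _ => h1 h2.
have -> : I1 - I2 =
    (I1 - al * (b - a) * (d - c)) - (I2 - al * (d - c) * (b - a)) by ring.
rewrite (le_trans (ler_normB _ _)) //.
have -> : e * s ^+ 2 = e * s * (d - c) + e * s * (b - a) by rewrite /s; ring.
exact: lerD.
Qed.

(** The left endpoints increase and the right endpoints decrease, so the supremum of the left
    endpoints lies in every segment. *)
Lemma nested_segments (xs : nat -> R) (L : R) : 0 <= L ->
  (forall n, xs n.+1 = xs n \/ xs n.+1 = xs n + L * 2^-1 ^+ n.+1) ->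
  exists x, forall n, xs n <= x <= xs n + L * 2^-1 ^+ n.
Proof.
move=> L0 hxs.
pose r n : R := L * 2^-1 ^+ n.
have r0 n : 0 <= r n by rewrite mulr_ge0 // exprn_ge0 // invr_ge0.
have rS n : r n = r n.+1 + r n.+1 by rewrite /r exprS; field.
have inc n k : xs n <= xs (n + k)%N.
  elim: k => [|k IH]; first by rewrite addn0.
  rewrite addnS (le_trans IH) //; have := r0 (n + k).+1; rewrite /r => h.
  by case: (hxs (n + k)%N) => ->; lra.
have dec n k : xs (n + k)%N + r (n + k)%N <= xs n + r n.
  elim: k => [|k IH]; first by rewrite addn0.
  rewrite addnS (le_trans _ IH) //; have := r0 (n + k).+1.
  have := rS (n + k)%N.
  by rewrite /r; case: (hxs (n + k)%N) => ->; lra.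
have ub n (m : nat) : xs m <= xs n + r n.
  have := inc m n; have := dec n m; have := r0 (n + m)%N.
  rewrite addnC; lra.
have hs : has_sup (range xs).
  by split; [exists (xs 0%N), 0%N|exists (xs 0%N + r 0%N) => _ [m _ <-]].
exists (sup (range xs)) => n; apply/andP; split.
  by apply: sup_upper_bound => //; exists n.
by apply: ge_sup => [|_ [m _ <-]]; [exists (xs 0%N), 0%N|].
Qed.

(** Repeated quartering keeps the flux at least [|J0| / 4^n], while the local estimate at the common
    point of the rectangles bounds it by [e * D^2 / 4^n], where [D] is the sum of the two original
    side lengths. *)
Theorem goursat u v a b c d : a <= b -> c <= d -> cr_on u v a b c d ->
  flux u v a b c d = 0.
Proof.
move=> ab cd cr; apply/eqP/negPn/negP => nz.
set J0 := flux u v a b c d in nz.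
pose w n := (b - a) * 2^-1 ^+ n; pose l n := (d - c) * 2^-1 ^+ n.
have w0 n : 0 <= w n by rewrite mulr_ge0 ?subr_ge0 // exprn_ge0 // invr_ge0.
have l0 n : 0 <= l n by rewrite mulr_ge0 ?subr_ge0 // exprn_ge0 // invr_ge0.
have wS n : w n = w n.+1 + w n.+1 by rewrite /w exprS; field.
have lS n : l n = l n.+1 + l n.+1 by rewrite /l exprS; field.
pose Q n (p : R * R) := [/\ a <= p.1, p.1 + w n <= b, c <= p.2, p.2 + l n <= d &
  `|J0| * 4^-1 ^+ n <= `|flux u v p.1 (p.1 + w n) p.2 (p.2 + l n)|].
pose S n (p p' : R * R) := [/\ Q n.+1 p',
  p'.1 = p.1 \/ p'.1 = p.1 + w n.+1 & p'.2 = p.2 \/ p'.2 = p.2 + l n.+1].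
(* The invariant [Q] sits under the existential so that [choice] returns a total function; a corner
   violating [Q] is sent to itself. *)
have step (np : nat * (R * R)) : exists p', Q np.1 np.2 -> S np.1 np.2 p'.
  case: np => n [p q] /=.
  case: (pselect (Q n (p, q))) => [|nQ]; last by exists (p, q).
  case=> /= p1 p2 q1 q2 hJ.
  have hcr : cr_on u v p (p + w n) q (q + l n) by apply: cr_on_sub cr.
  have := @flux_quarter u v p (p + w n) q (q + l n).
  rewrite !lerDl => /(_ (w0 n) (l0 n) hcr) /=.
  have -> : p + w n - p = w n by ring.
  have -> : q + l n - q = l n by ring.
  have -> : w n / 2 = w n.+1 by rewrite wS; field.
  have -> : l n / 2 = l n.+1 by rewrite lS; field.
  case=> p' [q' [hp' hq' hJ']]; exists (p', q') => _.
  have wn := w0 n.+1; have ln := l0 n.+1; have ws := wS n; have ls := lS n.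
  split => //; split => /=.
  - by case: hp' => ->; lra.
  - by case: hp' => ->; lra.
  - by case: hq' => ->; lra.
  - by case: hq' => ->; lra.
  - by rewrite exprS mulrCA mulrC; apply: le_trans hJ'; rewrite ler_pM2r ?invr_gt0.
have [f hf] := choice step.
pose s := fix s n := if n is k.+1 then f (k, s k) else (a, c).
have Qs n : Q n (s n).
  elim: n => [|n IH].
    have wa : a + w 0%N = b by rewrite /w expr0 mulr1 addrC subrK.
    have lc : c + l 0%N = d by rewrite /l expr0 mulr1 addrC subrK.
    by split; rewrite /= ?wa ?lc ?lexx // expr0 mulr1.
  by have [] := hf (n, s n) IH.
have Ss n : S n (s n) (s n.+1) by apply: (hf (n, s n)); exact: Qs.
have ba0 : 0 <= b - a by rewrite subr_ge0.
have dc0 : 0 <= d - c by rewrite subr_ge0.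
have [x hx] : exists x, forall n, (s n).1 <= x <= (s n).1 + w n.
  by apply: nested_segments => // n; have [] := Ss n.
have [y hy] : exists y, forall n, (s n).2 <= y <= (s n).2 + l n.
  by apply: nested_segments => // n; have [] := Ss n.
have hx0 : a <= x <= b.
  have /andP[x1 x2] := hx 0%N; have [h1 h2 _ _ _] := Qs 0%N.
  by rewrite (le_trans h1 x1) (le_trans x2 h2).
have hy0 : c <= y <= d.
  have /andP[x1 x2] := hy 0%N; have [_ _ h1 h2 _] := Qs 0%N.
  by rewrite (le_trans h1 x1) (le_trans x2 h2).
set D := b - a + (d - c).
have D0 : 0 <= D by rewrite addr_ge0.
have J0p : 0 < `|J0| by rewrite normr_gt0.
have DD : 0 < 2 * (D ^+ 2 + 1) by rewrite mulr_gt0 // ltr_wpDl // sqr_ge0.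
(* This makes [e * D^2] smaller than [|J0|]; the summand 1 keeps the denominator positive when [D]
   is 0. *)
pose e := `|J0| / (2 * (D ^+ 2 + 1)).
have e0 : 0 < e by rewrite divr_gt0.
have [del del0 hd] := flux_local (cr _ _ hx0 hy0) e0.
have [n hn] : exists n, D * 2^-1 ^+ n < del.
  have D1 : 0 < D + 1 by rewrite ltr_wpDl.
  have : (fun n : nat => (2^-1 : R) ^+ n) @ \oo --> (0 : R).
    by apply: cvg_expr; rewrite ger0_norm ?invr_ge0 // invf_lt1 // ltr1n.
  move=> /cvgrPdist_lt /(_ (del / (D + 1))); rewrite divr_gt0 // => /(_ isT).
  case=> n _ /(_ n (leqnn n)) /=.
  rewrite sub0r normrN ger0_norm ?exprn_ge0 ?invr_ge0 //.
  rewrite ltr_pdivlMr // => hn; exists n; apply: le_lt_trans hn.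
  by rewrite mulrC ler_wpM2l ?exprn_ge0 ?invr_ge0 // lerDl.
have wl : w n + l n = D * 2^-1 ^+ n by rewrite /w /l /D; ring.
have [h1 h2 h3 h4 h5] := Qs n.
have := hd _ _ _ _ (hx n) (hy n).
have wn := w0 n; have ln := l0 n.
have -> : (s n).1 + w n - (s n).1 = w n by ring.
have -> : (s n).2 + l n - (s n).2 = l n by ring.
have hw : w n < del by lra.
have hl : l n < del by lra.
have hcr : cr_on u v (s n).1 ((s n).1 + w n) (s n).2 ((s n).2 + l n).
  by apply: cr_on_sub cr.
move=> /(_ hw hl hcr) h6.
(* Both bounds scale like [4^-n]; cancelling this factor leaves [|J0| <= e * D^2], against the
   choice of [e]. *)
have := le_trans h5 h6; rewrite wl exprMn -exprM mulnC exprM.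
have -> : (2^-1 : R) ^+ 2 = 4^-1 by field.
rewrite mulrA ler_pM2r ?exprn_gt0 ?invr_gt0 //.
rewrite /e mulrAC ler_pdivlMr // ler_pM2l //.
have := sqr_ge0 D; lra.
Qed.

End Goursat.

(** * The modulus of a complex number and its real and imaginary parts *)

Section ComplexModulus.
Context {R : realType}.
Implicit Types (z w : R[i]).

Lemma sqr_cabs z : cabs z ^+ 2 = complex.Re z ^+ 2 + complex.Im z ^+ 2.
Proof. by case: z => a b; rewrite /cabs /= sqr_sqrtr // addr_ge0 ?sqr_ge0. Qed.

Lemma cabs_ge0 z : 0 <= cabs z.
Proof. by case: z => a b; rewrite /cabs /= sqrtr_ge0. Qed.

Lemma cabs0 : cabs (0 : R[i]) = 0.
Proof. exact: Normc.normc0. Qed.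

Lemma cabs1 : cabs (1 : R[i]) = 1.
Proof. exact: Normc.normc1. Qed.

Lemma cabsM z w : cabs (z * w) = cabs z * cabs w.
Proof. exact: Normc.normcM. Qed.

Lemma cabsD z w : cabs (z + w) <= cabs z + cabs w.
Proof. exact: le_normcD. Qed.

Lemma cabsN z : cabs (- z) = cabs z.
Proof. exact: normcN. Qed.

Lemma cabsJ z : cabs (conjc z) = cabs z.
Proof. by case: z => a b; rewrite /cabs /= sqrrN. Qed.

Lemma cabs_real (x : R) : cabs x%:C%C = `|x|.
Proof. by rewrite /cabs /= expr0n addr0 sqrtr_sqr. Qed.

Lemma normr_Re_cabs z : `|complex.Re z| <= cabs z.
Proof.
rewrite -(@ler_pXn2r _ 2) ?nnegrE ?cabs_ge0 // sqr_cabs real_normK ?num_real //.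
by rewrite lerDl sqr_ge0.
Qed.

Lemma normr_Im_cabs z : `|complex.Im z| <= cabs z.
Proof.
rewrite -(@ler_pXn2r _ 2) ?nnegrE ?cabs_ge0 // sqr_cabs real_normK ?num_real //.
by rewrite lerDr sqr_ge0.
Qed.

Lemma Re_le_cabs z : complex.Re z <= cabs z.
Proof. exact: le_trans (ler_norm _) (normr_Re_cabs _). Qed.

Lemma cabs_le_normD (a b : R) : cabs (a +i* b)%C <= `|a| + `|b|.
Proof.
rewrite -(@ler_pXn2r _ 2) ?nnegrE ?cabs_ge0 ?addr_ge0 // sqr_cabs /=.
rewrite sqrrD !real_normK ?num_real // addrAC lerDl.
by rewrite mulrn_wge0 // mulr_ge0.
Qed.

Lemma ReB z w : complex.Re (z - w) = complex.Re z - complex.Re w.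
Proof. by case: z; case: w. Qed.

Lemma ImB z w : complex.Im (z - w) = complex.Im z - complex.Im w.
Proof. by case: z; case: w. Qed.

Lemma mulJc z : conjc z * z = (cabs z ^+ 2)%:C%C.
Proof.
rewrite sqr_cabs; case: z => a b; apply/eqP; rewrite eq_complex /=.
by apply/andP; split; apply/eqP; ring.
Qed.

End ComplexModulus.

(** * Polar coordinates and the mean value argument on a disc *)

Section PolarCoordinates.
Context {R : realType}.
Implicit Types (x y h k e : R).

Definition cexp x y : R[i] := ((expR x * cos y) +i* (expR x * sin y))%C.

Lemma cexpD x y h k : cexp (x + h) (y + k) = cexp x y * cexp h k.
Proof.
rewrite /cexp expRD cosD sinD; apply/eqP; rewrite eq_complex /=.
by apply/andP; split; apply/eqP; ring.
Qed.

Lemma cabs_cexp x y : cabs (cexp x y) = expR x.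
Proof.
apply/eqP; rewrite -(@eqrXn2 _ 2) ?cabs_ge0 ?expR_ge0 // sqr_cabs /=.
by rewrite !exprMn -mulrDr cos2Dsin2 mulr1.
Qed.

Lemma cexp_period x : cexp x (pi *+ 2) = cexp x 0.
Proof. by rewrite /cexp cos2pi sin2pi cos0 sin0. Qed.

Lemma cexp_ln (t : R) : 0 < t -> cexp (ln t) 0 = t%:C%C.
Proof. by move=> t0; rewrite /cexp lnK ?posrE // cos0 sin0 mulr1 mulr0. Qed.

Lemma is_derive_lin_approx (f : R -> R) x df : is_derive x 1 f df ->
  forall e, 0 < e -> exists2 del : R, 0 < del &
    forall h, `|h| < del -> `|f (x + h) - f x - df * h| <= e * `|h|.
Proof.
move=> [dv <-] e e0.
have /cvgrPdist_le /(_ e e0) := dv.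
rewrite near_withinE => /nbhs_ballP[del /= del0 hd].
(* The limit of the difference quotient ignores [h = 0], where the estimate is trivial. *)
exists del => // h hdel; have [->|h0] := eqVneq h 0.
  by rewrite addr0 subrr mulr0 subrr normr0 mulr0.
have := hd h; rewrite /ball /= sub0r normrN => /(_ hdel h0).
rewrite /= /shift scaler1 distrC => hh.
have -> : f (x + h) - f x - 'D_1 f x * h =
    h * (h^-1 *: (f (h + x) - f x) - 'D_1 f x).
  by rewrite mulrBr /GRing.scale /= mulrA divff // mul1r [h + x]addrC [h * _]mulrC.
by rewrite normrM mulrC ler_wpM2r.
Qed.

(** The exponential has derivative 1 at 0; [cexpD] transports this to every other point. *)
Lemma cexp_lin_approx0 e : 0 < e -> exists2 del : R, 0 < del &
  forall h k, `|h| < del -> `|k| < del ->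
    cabs (cexp h k - 1 - (h +i* k)%C) <= e * (`|h| + `|k|).
Proof.
(* The final error is at most [8 * e' * |k| + e' * |h|], with 8 = 3 + 3 + 2 from [t1], [t2] and
   [t3]. The cap 1 gives the bounds [E1] and [E3]. *)
move=> e0; pose e' := Num.min (e / 8) 1.
have e'0 : 0 < e' by rewrite lt_min ltr01 andbT divr_gt0.
have e'1 : e' <= 1 by rewrite ge_min lexx orbT.
have e'e : e' <= e / 8 by rewrite ge_min lexx.
clearbody e'.
have [d1 d10 h1] := is_derive_lin_approx (is_derive_expR 0) e'0.
have [d2 d20 h2] := is_derive_lin_approx (is_derive_cos 0) e'0.
have [d3 d30 h3] := is_derive_lin_approx (is_derive_sin 0) e'0.
(* Having [|h| < e'] as well makes the product [(expR h - 1) * k] small enough. *)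
exists (Num.min e' (Num.min d1 (Num.min d2 d3))); first by rewrite !lt_min e'0 d10 d20.
move=> h k; rewrite !lt_min => /and4P[he hd1 _ _] /and4P[_ _ kd2 kd3].
have := h1 _ hd1; have := h2 _ kd2; have := h3 _ kd3.
rewrite !add0r expR0 cos0 sin0 !subr0 oppr0 mul0r !subr0 !mul1r => s c E.
rewrite /cexp (_ : _ - _ - _ =
  ((expR h * (cos k - 1) + (expR h - 1 - h)) +i*
   (expR h * (sin k - k) + (expR h - 1) * k))%C); last first.
  by apply/eqP; rewrite eq_complex /=; apply/andP; split; apply/eqP; ring.
apply: le_trans (cabs_le_normD _ _) _.
have nh := normr_ge0 h; have nk := normr_ge0 k.
have E1 : `|expR h - 1| <= 2 * `|h|.
  rewrite -[expR h - 1](subrK h) (le_trans (ler_normD _ _)) //.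
  have : e' * `|h| <= 1 * `|h| by rewrite ler_wpM2r.
  lra.
have E3 : `|expR h| <= 3.
  rewrite -[expR h](subrK 1) (le_trans (ler_normD _ _)) // normr1.
  have : `|h| <= 1 by rewrite (le_trans (ltW he)).
  lra.
have t1 : `|expR h * (cos k - 1)| <= 3 * (e' * `|k|).
  by rewrite normrM ler_pM.
have t2 : `|expR h * (sin k - k)| <= 3 * (e' * `|k|).
  by rewrite normrM ler_pM.
have t3 : `|(expR h - 1) * k| <= 2 * (e' * `|k|).
  rewrite normrM mulrA ler_wpM2r //; apply: le_trans E1 _.
  by rewrite ler_pM2l // ltW.
have s1 := ler_normD (expR h * (cos k - 1)) (expR h - 1 - h).
have s2 := ler_normD (expR h * (sin k - k)) ((expR h - 1) * k).
have p1 : e' * `|k| <= e / 8 * `|k| by rewrite ler_wpM2r.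
have p2 : e' * `|h| <= e / 8 * `|h| by rewrite ler_wpM2r.
have p3 : 0 <= e / 8 * `|h| by rewrite mulr_ge0 // divr_ge0 // ltW.
lra.
Qed.

Definition complex_differentiable (F : R[i] -> R[i]) (w : R[i]) :=
  exists A, forall e, 0 < e -> exists2 del : R, 0 < del &
    forall k : R[i], cabs k < del -> cabs (F (w + k) - F w - A * k) <= e * cabs k.

(** By the chain rule the derivative is multiplication by [B = A * w], whose real matrix has [Re B]
    twice on the diagonal; this is the shared coefficient [al]. *)
Lemma cr_differentiable_polar F x y : complex_differentiable F (cexp x y) ->
  cr_differentiable (fun x y => complex.Re (F (cexp x y)))
                    (fun x y => complex.Im (F (cexp x y))) x y.
Proof.
set w := cexp x y => -[A hA]; pose B := A * w.
exists (complex.Re B), (- complex.Im B), (complex.Im B) => e e0.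
have w0 := cabs_ge0 w; have B0 := cabs_ge0 B.
(* Half of [e] pays for the error of the exponential, multiplied by [B]; the other half pays for the
   error of [F] at the increment [w * q], of modulus at most [2 * cabs w * s]. *)
pose e1 := Num.min 1 (e / (2 * (cabs B + 1))).
have dB : 0 < 2 * (cabs B + 1) by lra.
have dw : 0 < 4 * (cabs w + 1) by lra.
have e10 : 0 < e1 by rewrite lt_min ltr01 divr_gt0.
have e11 : e1 <= 1 by rewrite ge_min lexx.
have e1B : cabs B * e1 <= e / 2.
  have : e1 <= e / (2 * (cabs B + 1)) by rewrite ge_min lexx orbT.
  rewrite ler_pdivlMr // => h; lra.
have [d1 d10 h1] := cexp_lin_approx0 e10.
have e20 : 0 < e / (4 * (cabs w + 1)) by rewrite divr_gt0.
have [d2 d20 h2] := hA _ e20.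
exists (Num.min d1 (d2 / (4 * (cabs w + 1)))).
  by rewrite lt_min d10 divr_gt0.
move=> h k; rewrite !lt_min => /andP[hd1 hd2] /andP[kd1 kd2].
have q1 := h1 _ _ hd1 kd1.
set q := cexp h k - 1 in q1; set s := `|h| + `|k| in q1 *.
have s0 : 0 <= s by rewrite addr_ge0.
have sd : s * (2 * (cabs w + 1)) < d2.
  move: hd2 kd2; rewrite !ltr_pdivlMr // /s; lra.
have qs : cabs q <= 2 * s.
  rewrite -[q](subrK (h +i* k)%C) (le_trans (cabsD _ _)) //.
  have := cabs_le_normD h k; rewrite -/s.
  have : e1 * s <= 1 * s by rewrite ler_wpM2r.
  lra.
have kw : cabs (w * q) <= 2 * cabs w * s.
  by rewrite cabsM -mulrA mulrCA ler_wpM2l.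
have kd : cabs (w * q) < d2 by apply: le_lt_trans kw _; lra.
have := h2 _ kd.
have -> : w + w * q = cexp (x + h) (y + k) by rewrite cexpD -/w /q; ring.
set Fw := F (cexp _ _) => h3.
have h4 : cabs (Fw - F w - B * (h +i* k)%C) <= e * s.
  have -> : Fw - F w - B * (h +i* k)%C =
      (Fw - F w - A * (w * q)) + B * (q - (h +i* k)%C) by rewrite /B; ring.
  apply: le_trans (cabsD _ _) _; rewrite cabsM.
  have t1 : cabs B * cabs (q - (h +i* k)%C) <= e / 2 * s.
    apply: le_trans (_ : cabs B * (e1 * s) <= _); first by rewrite ler_wpM2l.
    by rewrite mulrA ler_wpM2r.
  have t2 : e / (4 * (cabs w + 1)) * cabs (w * q) <= e / 2 * s.
    rewrite mulrAC ler_pdivrMr // -!mulrA ler_pM2l //; lra.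
  lra.
have hB : complex.Re (B * (h +i* k)%C) = complex.Re B * h + - complex.Im B * k /\
          complex.Im (B * (h +i* k)%C) = complex.Im B * h + complex.Re B * k.
  by case: (B) => p r /=; split; ring.
case: hB => hB1 hB2; split.
- by rewrite -hB1 -!ReB (le_trans (normr_Re_cabs _)).
- by rewrite -hB2 -!ImB (le_trans (normr_Im_cabs _)).
Qed.

Lemma complex_differentiable_cts F w : complex_differentiable F w ->
  forall e, 0 < e -> exists2 del : R, 0 < del &
    forall k : R[i], cabs k < del -> cabs (F (w + k) - F w) <= e.
Proof.
move=> [A hA] e e0; have [d d0 h] := hA _ ltr01.
have K0 : 0 < cabs A + 1 by rewrite ltr_wpDl ?cabs_ge0.
exists (Num.min d (e / (cabs A + 1))); first by rewrite lt_min d0 divr_gt0.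
move=> k; rewrite lt_min => /andP[/h + ]; rewrite ltr_pdivlMr // mul1r => h1 h2.
rewrite -[F _ - _](subrK (A * k)) (le_trans (cabsD _ _)) // cabsM.
move: h1 h2; lra.
Qed.

(** The nonnegative function [Re (F 0) - Re F] has integral 0 over the circle of radius [t], hence
    vanishes at the angle 0, which is the point [t]. *)
Lemma Re_maximum_at_center (F : R[i] -> R[i]) (rho t : R) :
  (forall w, cabs w < rho -> complex_differentiable F w) ->
  (forall w, cabs w < rho -> complex.Re (F w) <= complex.Re (F 0)) ->
  0 < t -> t < rho -> complex.Re (F t%:C%C) = complex.Re (F 0).
Proof.
move=> dF maxF t0 trho.
pose u x y := complex.Re (F (cexp x y)); pose v x y := complex.Im (F (cexp x y)).
pose X := ln t; pose T : R := pi *+ 2.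
have T0 : 0 < T by rewrite mulrn_wgt0 // pi_gt0.
have eX : expR X = t by rewrite lnK ?posrE.
have lt_rho x : x <= X -> expR x < rho.
  by move=> xX; apply: le_lt_trans trho; rewrite -eX ler_expR.
have cr x y : x <= X -> cr_differentiable u v x y.
  move=> xX; apply: cr_differentiable_polar; apply: dF.
  by rewrite cabs_cexp lt_rho.
have cu x : x <= X -> continuous_on_segment 0 T (u x).
  by move=> xX y _; have [] := cr_continuous (cr x y xX).
(* The two horizontal sides of [[a, X] x [0, T]] cancel by periodicity, so zero flux equates the
   integrals over the two circles. *)
have circle a : a <= X -> segment_integral 0 T (u X) = segment_integral 0 T (u a).
  move=> aX; have hcr : cr_on u v a X 0 T.
    by move=> x y /andP[_ xX] _; exact: cr.
  have := goursat aX (ltW T0) hcr; rewrite /flux.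
  have -> : (fun x => v x T - v x 0) = fun=> 0.
    by apply/funext => x; rewrite /v cexp_period subrr.
  rewrite segment_integral_cst // mul0r subr0 segment_integralB; try exact: cu.
  by move/eqP; rewrite subr_eq0 => /eqP.
pose u0 := complex.Re (F 0).
have cX : continuous_on_segment 0 T (fun y => u0 - u X y).
  by apply: continuous_on_segmentB; [exact: continuous_on_segment_cst|exact: cu].
have int0 : segment_integral 0 T (fun y => u0 - u X y) <= 0.
  apply/ler_addgt0Pl => e e0; rewrite addr0.
  have d0F : complex_differentiable F 0 by apply: dF; rewrite cabs0 (lt_trans t0).
  have eT : 0 < e / T by rewrite divr_gt0.
  have [del del0 hd] := complex_differentiable_cts d0F eT.
  (* The circle of radius [r] lies where continuity at 0 applies, and [r <= t] is what [circle]
     requires. *)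
  pose r := Num.min (del / 2) t.
  have r0 : 0 < r by rewrite lt_min t0 divr_gt0.
  have rt : r <= t by rewrite ge_min lexx orbT.
  have rd : r < del.
    by apply: le_lt_trans (_ : del / 2 < del); [rewrite ge_min lexx|lra].
  have aX : ln r <= X by rewrite ler_ln ?posrE.
  rewrite segment_integralB; [|exact: continuous_on_segment_cst|exact: cu].
  rewrite (circle _ aX) -segment_integralB;
    [|exact: continuous_on_segment_cst|exact: cu].
  apply: le_trans (_ : e / T * (T - 0) <= _); last by rewrite subr0 divfK ?gt_eqF.
  apply: le_segment_integral_cst; first exact: ltW.
    by apply: continuous_on_segmentB; [exact: continuous_on_segment_cst|exact: cu].
  move=> y _; apply: le_trans (ler_norm _) _; rewrite distrC.
  rewrite -ReB (le_trans (normr_Re_cabs _)) //.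
  have := hd (cexp (ln r) y); rewrite add0r cabs_cexp lnK ?posrE //.
  by apply.
have := segment_integral_eq0 T0 cX _ int0.
rewrite /u /X cexp_ln // => h; apply/eqP; rewrite eq_sym -subr_eq0 h //.
by move=> y _; rewrite subr_ge0 maxF // cabs_cexp lt_rho.
Qed.

End PolarCoordinates.

(** * Compactness of the closed ball and the maximum modulus principle *)

Section BallCompactness.
Context {R : realType} {d : nat}.
Implicit Types (z w : cvec R d) (f g : cvec R d -> R[i]).

Lemma vnorm_ge0 z : 0 <= vnorm z.
Proof. exact: sqrtr_ge0. Qed.

Lemma sqr_vnorm z : vnorm z ^+ 2 = \sum_(i < d) cabs (z i) ^+ 2.
Proof. by rewrite sqr_sqrtr // sumr_ge0 // => i _; exact: sqr_ge0. Qed.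

Lemma vnorm_lt z (e : R) : 0 < e ->
  \sum_(i < d) cabs (z i) ^+ 2 < e ^+ 2 -> vnorm z < e.
Proof.
by move=> e0 h; rewrite -(@ltr_pXn2r _ 2) ?nnegrE ?vnorm_ge0 ?ltW // sqr_vnorm.
Qed.

Lemma closed_ballP z : closed_ball z <-> \sum_(i < d) cabs (z i) ^+ 2 <= 1.
Proof.
rewrite -sqr_vnorm /closed_ball /=; split => [h|].
  by rewrite expr_le1 // vnorm_ge0.
by rewrite expr_le1 // vnorm_ge0.
Qed.

Lemma cabs_le_vnorm z i : cabs (z i) <= vnorm z.
Proof.
rewrite -(@ler_pXn2r _ 2) ?nnegrE ?vnorm_ge0 ?cabs_ge0 // sqr_vnorm.
by rewrite (bigD1 i) //= lerDl sumr_ge0 // => j _; exact: sqr_ge0.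
Qed.

Lemma vnormZ (c : R[i]) z : vnorm (fun i => c * z i) = cabs c * vnorm z.
Proof.
apply/eqP; rewrite -(@eqrXn2 _ 2) ?mulr_ge0 ?cabs_ge0 ?vnorm_ge0 //.
rewrite exprMn !sqr_vnorm mulr_sumr; apply/eqP/eq_bigr => i _.
by rewrite cabsM exprMn.
Qed.

(** The real parts come first, then the imaginary parts. Real row vectors carry the topology in
    which compactness is proved before being transported to the ball. *)
Definition cvec_of_row (x : 'rV[R]_(d + d)) : cvec R d :=
  fun i => (x 0 (lshift d i) +i* x 0 (rshift d i))%C.

Lemma cvec_of_row_surj z : exists x, cvec_of_row x = z.
Proof.
exists (row_mx (\row_i complex.Re (z i)) (\row_i complex.Im (z i))).
apply/funext => i; rewrite /cvec_of_row row_mxEl row_mxEr !mxE.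
by case: (z i).
Qed.

Lemma sum_continuous (T : topologicalType) n (F : 'I_n -> T -> R) :
  (forall i, continuous (F i)) -> continuous (fun x => \sum_(i < n) F i x).
Proof.
elim: n F => [|n IH] F cF x.
  by under eq_fun do rewrite big_ord0; exact: cst_continuous.
under eq_fun do rewrite big_ord_recr /=.
by apply: continuousD; [apply: (IH (fun i => F (widen_ord (leqnSn n) i)))|exact: cF].
Qed.

(** This links the topology of rows to [vnorm]: with [x0 = 0] it shows that the ball is closed, and
    with [x0] a point of the ball it turns [vnorm]-continuity into continuity on rows. *)
Lemma sqr_norm_row_continuous (x0 : 'rV[R]_(d + d)) :
  continuous (fun x =>
    \sum_(i < d) cabs (vsub (cvec_of_row x) (cvec_of_row x0) i) ^+ 2).
Proof.
apply: sum_continuous => i x.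
have -> : (fun x => cabs (vsub (cvec_of_row x) (cvec_of_row x0) i) ^+ 2) =
    (fun x => (x 0 (lshift d i) - x0 0 (lshift d i)) ^+ 2 +
              (x 0 (rshift d i) - x0 0 (rshift d i)) ^+ 2).
  by apply/funext => y; rewrite sqr_cabs.
have cj j : {for x, continuous (fun x : 'rV[R]_(d + d) => (x 0 j - x0 0 j) ^+ 2)}.
  have -> : (fun y : 'rV[R]_(d + d) => (y 0 j - x0 0 j) ^+ 2) =
      (fun y => (y 0 j - x0 0 j) * (y 0 j - x0 0 j)).
    by apply/funext => y; rewrite expr2.
  by apply: continuousM; (apply: continuousB;
    [exact: coord_continuous|exact: cst_continuous]).
exact: (continuousD (cj (lshift d i)) (cj (rshift d i))).
Qed.

(** The ball is a closed part of the cube [[-1, 1]^(2d)]. *)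
Lemma compact_ball_rows : compact [set x | closed_ball (cvec_of_row x)].
Proof.
have cbox : compact
    [set x : 'rV[R]_(d + d) | forall i, `[(-1), 1]%classic (x ord0 i)].
  apply: (@rV_compact R _ (fun=> `[(-1), 1]%classic)).
  by move=> _; exact: segment_compact.
apply: subclosed_compact cbox _.
  have -> : [set x | closed_ball (cvec_of_row x)] =
     (fun x => \sum_(i < d) cabs (vsub (cvec_of_row x) (cvec_of_row 0) i) ^+ 2)
       @^-1` [set t | t <= 1].
    have v0 x : vsub (cvec_of_row x) (cvec_of_row 0) = cvec_of_row x.
      apply/funext => i; apply/eqP.
      by rewrite eq_complex /vsub /cvec_of_row /= !mxE !subr0 !eqxx.
    apply/funext => x; apply/propext; rewrite /preimage /mkset v0.
    exact: closed_ballP.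
  apply: preimage_closed; last exact: closed_le.
  by move=> x _; exact: sqr_norm_row_continuous.
move=> x /= hx i; rewrite in_itv /= -ler_norml.
have hi j : cabs (cvec_of_row x j) <= 1 := le_trans (cabs_le_vnorm _ _) hx.
case: (split_ordP i) => j ->; apply: le_trans (hi j).
  exact: (normr_Re_cabs (cvec_of_row x j)).
exact: (normr_Im_cabs (cvec_of_row x j)).
Qed.

Lemma closed_ball0 : closed_ball (fun=> 0 : R[i]) (d := d).
Proof.
by apply/closed_ballP; rewrite big1 // => i _; rewrite cabs0 expr0n.
Qed.

Lemma closed_ball_max f : continuous_on_closed_ball f ->
  exists2 z, closed_ball z & forall w, closed_ball w -> cabs (f w) <= cabs (f z).
Proof.
move=> cf.
have [x0 hx0] := cvec_of_row_surj (fun=> 0).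
have K0 : [set x | closed_ball (cvec_of_row x)] !=set0.
  by exists x0 => /=; rewrite hx0; exact: closed_ball0.
have cg : {within [set x | closed_ball (cvec_of_row x)],
           continuous (fun x => cabs (f (cvec_of_row x)))}.
  apply/subspace_continuousP => x Kx; apply/cvgrPdist_lt => e e0.
  have [del del0 hd] := cf _ Kx _ e0.
  rewrite near_withinE.
  have := @sqr_norm_row_continuous x x.
  move=> /cvgrPdist_lt /(_ (del ^+ 2)); rewrite exprn_gt0 // => /(_ isT).
  apply: filterS => y; rewrite big1; last first.
    by move=> i _; rewrite /vsub subrr cabs0 expr0n.
  rewrite sub0r normrN ger0_norm; last by apply: sumr_ge0 => i _; exact: sqr_ge0.
  move=> /(vnorm_lt del0) hy Ky; have {hd hy} := hd _ Ky hy.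
  rewrite /from_subspace.
  set a := f _; set b := f _ => ab.
  have h1 := cabsD (a - b) b; have h2 := cabsD (b - a) a.
  have h3 : cabs (b - a) = cabs (a - b) by rewrite -cabsN opprB.
  rewrite !subrK in h1 h2; rewrite ltr_norml; apply/andP; split; lra.
have [x Kx hx] := compact_EVT_max K0 compact_ball_rows cg.
exists (cvec_of_row x); first by rewrite inE in Kx.
move=> w hw; have [y yw] := cvec_of_row_surj w.
by rewrite -yw; apply: hx; rewrite inE /= yw.
Qed.

(** [sup] is a least upper bound only for a nonempty set that is bounded above; a maximum point
    provides both. *)
Lemma supnorm_has_sup f : continuous_on_closed_ball f ->
  has_sup [set cabs (f z) | z in closed_ball (d := d)].
Proof.
move=> /closed_ball_max[z hz hm]; split; first by exists (cabs (f z)), z.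
by exists (cabs (f z)) => _ [w hw <-]; exact: hm.
Qed.

Lemma cabs_le_supnorm f z : continuous_on_closed_ball f -> closed_ball z ->
  cabs (f z) <= supnorm f.
Proof.
by move=> cf hz; apply: sup_upper_bound; [exact: supnorm_has_sup|exists z].
Qed.

Lemma supnorm_le f (B : R) : (forall z, closed_ball z -> cabs (f z) <= B) ->
  supnorm f <= B.
Proof.
move=> h; apply: ge_sup; last by move=> _ [w hw <-]; exact: h.
by exists (cabs (f (fun=> 0))), (fun=> 0) => //; exact: closed_ball0.
Qed.

Lemma supnorm_attained f : continuous_on_closed_ball f ->
  exists2 z, closed_ball z & cabs (f z) = supnorm f.
Proof.
move=> cf; have [z hz hm] := closed_ball_max cf; exists z => //.
by apply/eqP; rewrite eq_le cabs_le_supnorm // supnorm_le.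
Qed.

(* The slice of [f] through the origin and its maximum point [z = r u] is
   constant in modulus on the radius of a disc centred at [z] that touches the
   unit sphere at [u]. *)
Lemma supnorm_attained_sphere f : (0 < d)%N -> ball_algebra f ->
  exists2 z, unit_sphere z & cabs (f z) = supnorm f.
Proof.
move=> d0 [hf cf]; have [z hz zM] := supnorm_attained cf.
set M := supnorm f in zM *.
have M0 : 0 <= M by rewrite -zM cabs_ge0.
have leM w : closed_ball w -> cabs (f w) <= M by exact: cabs_le_supnorm.
have [r [u [r0 r1 u1 zu]]] : exists (r : R) (u : cvec R d),
    [/\ 0 <= r, r <= 1, vnorm u = 1 & z = fun i => r%:C%C * u i].
  have [z0|z0] := eqVneq (vnorm z) 0.
    (* When [z = 0] any unit direction serves; the first basis vector exists because [0 < d]. *)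
    exists 0, (fun i => if i == Ordinal d0 then 1 else 0); split => //.
      apply/eqP; rewrite -(@eqrXn2 _ 2) ?vnorm_ge0 // sqr_vnorm expr1n.
      rewrite (bigD1 (Ordinal d0)) // eqxx cabs1 expr1n big1.
        by rewrite /= addr0.
      by move=> i /andP[_ /negbTE ->]; rewrite cabs0 expr0n.
    apply/funext => i; rewrite mul0r; apply: Normc.eq0_normc.
    by apply/eqP; rewrite eq_le cabs_ge0 andbT -z0 cabs_le_vnorm.
  have zp : 0 < vnorm z by rewrite lt_neqAle eq_sym z0 vnorm_ge0.
  exists (vnorm z), (fun i => ((vnorm z)^-1)%:C%C * z i); split => //.
    exact: ltW.
    by rewrite vnormZ cabs_real ger0_norm ?invr_ge0 ?vnorm_ge0 // mulVf.
  by apply/funext => i; rewrite mulrA -rmorphM divff // rmorph1 mul1r.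
exists u => //.
have [r1'|r1'] := eqVneq r 1.
  by rewrite -zM zu r1'; congr (cabs (f _)); apply/funext => i; rewrite mul1r.
have {r1'}r1 : r < 1 by rewrite lt_neqAle r1' r1.
pose sl (w : R[i]) : cvec R d := fun i => (r%:C%C + w) * u i.
have nsl (w : R[i]) : vnorm (sl w) = cabs (r%:C%C + w) by rewrite vnormZ u1 mulr1.
have slb (w : R[i]) : cabs w < 1 - r -> open_ball (sl w).
  move=> hw; rewrite /open_ball /= nsl; apply: le_lt_trans (cabsD _ _) _.
  by rewrite cabs_real ger0_norm //; lra.
have sl0 : sl 0 = z by rewrite zu; apply/funext => i; rewrite /sl addr0.
(* The factor rotates the value at the centre to the real number [M^2], so that a maximum of the
   modulus of [f] becomes a maximum of the real part of [F]. *)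
pose F (w : R[i]) := conjc (f z) * f (sl w).
have dF (w : R[i]) : cabs w < 1 - r -> complex_differentiable F w.
  move=> /slb /hf [a ha].
  exists (conjc (f z) * \sum_(i < d) a i * u i) => e e0.
  have K0 : 0 < M + 1 by rewrite ltr_wpDl.
  have [del del0 hd] := ha _ (divr_gt0 e0 K0).
  exists del => // k hk.
  have nk : vnorm (fun i => k * u i) = cabs k by rewrite vnormZ u1 mulr1.
  have := hd (fun i => k * u i); rewrite nk => /(_ hk).
  have -> : vadd (sl w) (fun i => k * u i) = sl (w + k).
    by apply/funext => i; rewrite /vadd /sl; ring.
  have -> : \sum_(i < d) a i * (k * u i) = k * \sum_(i < d) a i * u i.
    by rewrite mulr_sumr; apply: eq_bigr => i _; ring.
  set S := \sum_(i < d) _ => hS.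
  have -> : F (w + k) - F w - conjc (f z) * S * k =
     conjc (f z) * (f (sl (w + k)) - f (sl w) - k * S) by rewrite /F; ring.
  rewrite cabsM cabsJ zM; apply: le_trans (ler_wpM2l M0 hS) _.
  rewrite mulrA ler_wpM2r ?cabs_ge0 // mulrCA; apply: ler_piMr; first exact: ltW.
  by rewrite ler_pdivrMr // mul1r lerDl.
have F0 : F 0 = (M ^+ 2)%:C%C by rewrite /F sl0 mulJc zM.
have maxF (w : R[i]) : cabs w < 1 - r -> complex.Re (F w) <= complex.Re (F 0).
  move=> hw; rewrite F0 /=; apply: le_trans (Re_le_cabs _) _.
  rewrite cabsM cabsJ zM expr2 ler_wpM2l // leM //.
  exact: ltW (slb _ hw).
(* Here [M^2 = Re (F t) <= M * cabs (f (sl t))], and [M] is cancelled unless it is 0. *)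
have radius (t : R) : 0 < t -> t < 1 - r -> M <= cabs (f (sl t%:C%C)).
  move=> t0 t1; have := Re_le_cabs (F t%:C%C).
  rewrite (Re_maximum_at_center dF maxF t0 t1) F0 /= cabsM cabsJ zM expr2.
  have [->|Mn] := eqVneq M 0; first by rewrite cabs_ge0.
  by rewrite ler_pM2l // lt_neqAle eq_sym Mn.
have cu : closed_ball u by rewrite /closed_ball /= u1.
apply/eqP; rewrite eq_le leM //= leNgt; apply/negP => ltM.
have e0 : 0 < M - cabs (f u) by rewrite subr_gt0.
have [del del0 hd] := cf _ cu _ e0.
(* The parameter [1 - r - s] gives the point [(1 - s) u], at distance [s < del] from [u]; the second
   bound keeps the parameter positive. *)
pose s := Num.min (del / 2) ((1 - r) / 2).
have s0 : 0 < s by rewrite lt_min !divr_gt0 // subr_gt0.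
have s1 : s <= (1 - r) / 2 by rewrite ge_min lexx orbT.
have s2 : s <= del / 2 by rewrite ge_min lexx.
have t0 : 0 < 1 - r - s by lra.
have t1 : 1 - r - s < 1 - r by lra.
have M1 := radius _ t0 t1.
have cs : closed_ball (sl (1 - r - s)%:C%C).
  by apply: ltW; apply: slb; rewrite cabs_real ger0_norm // ltW.
have E : vsub (sl (1 - r - s)%:C%C) u = fun i => (- s)%:C%C * u i.
  apply/funext => i; rewrite /vsub /sl -rmorphD.
  have -> : r + (1 - r - s) = 1 - s by ring.
  by rewrite rmorphB rmorph1 rmorphN; ring.
have := hd _ cs; rewrite E vnormZ u1 mulr1 cabs_real normrN ger0_norm ?ltW //.
have sd : s < del by lra.
move=> /(_ sd); have := cabsD (f (sl (1 - r - s)%:C%C) - f u) (f u).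
rewrite subrK; lra.
Qed.

End BallCompactness.

(** * Elements of the ball algebra, the peak function, and functionals that attain their norm on
    it *)

Section BallAlgebraElements.
Context {R : realType} {d : nat}.
Implicit Types (z w zeta : cvec R d) (f g h : cvec R d -> R[i]).

Lemma ball_algebra_lin (a : R[i]) f g : ball_algebra f -> ball_algebra g ->
  ball_algebra (fun z => a * f z + g z).
Proof.
move=> [hf cf] [hg cg].
have K0 : 0 < 2 * (cabs a + 1) by rewrite mulr_gt0 // ltr_wpDl ?cabs_ge0.
have aK (e : R) : 0 < e -> cabs a * (e / (2 * (cabs a + 1))) <= e / 2.
  move=> e0; rewrite mulrA ler_pdivrMr //.
  have -> : e / 2 * (2 * (cabs a + 1)) = e * (cabs a + 1) by field.
  by rewrite mulrC ler_pM2l // lerDl.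
split => z hz.
  have [al hal] := hf _ hz; have [be hbe] := hg _ hz.
  exists (fun i => a * al i + be i) => e e0.
  have [d1 d10 h1] := hal _ (divr_gt0 e0 K0).
  have e2 : 0 < e / 2 by rewrite divr_gt0.
  have [d2 d20 h2] := hbe _ e2.
  exists (Num.min d1 d2); first by rewrite lt_min d10.
  move=> h; rewrite lt_min => /andP[/h1 {}h1 /h2 {}h2].
  have -> : \sum_(i < d) (a * al i + be i) * h i =
      a * (\sum_(i < d) al i * h i) + \sum_(i < d) be i * h i.
    rewrite mulr_sumr -big_split /=; apply: eq_bigr => i _; ring.
  move: h1 h2; set S1 := \sum_(i < d) _; set S2 := \sum_(i < d) _ => h1 h2.
  have -> : a * f (vadd z h) + g (vadd z h) - (a * f z + g z) - (a * S1 + S2) =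
    a * (f (vadd z h) - f z - S1) + (g (vadd z h) - g z - S2) by ring.
  apply: le_trans (cabsD _ _) _; rewrite cabsM.
  have h3 := ler_wpM2l (cabs_ge0 a) h1.
  have h4 : cabs a * (e / (2 * (cabs a + 1)) * vnorm h) <= e / 2 * vnorm h.
    by rewrite mulrA ler_wpM2r ?vnorm_ge0 ?aK.
  lra.
move=> e e0.
have [d1 d10 h1] := cf _ hz _ (divr_gt0 e0 K0).
have e2 : 0 < e / 2 by rewrite divr_gt0.
have [d2 d20 h2] := cg _ hz _ e2.
exists (Num.min d1 d2); first by rewrite lt_min d10.
move=> w hw; rewrite lt_min => /andP[/(h1 _ hw) {}h1 /(h2 _ hw) {}h2].
have -> : a * f w + g w - (a * f z + g z) = a * (f w - f z) + (g w - g z) by ring.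
apply: le_lt_trans (cabsD _ _) _; rewrite cabsM.
have h3 := ler_wpM2l (cabs_ge0 a) (ltW h1).
have h4 := aK _ e0.
lra.
Qed.

Lemma cabs_sum n (F : 'I_n -> R[i]) :
  cabs (\sum_(i < n) F i) <= \sum_(i < n) cabs (F i).
Proof.
elim/big_ind2: _ => [|x1 x2 y1 y2 h1 h2|//]; first by rewrite cabs0.
exact: le_trans (cabsD _ _) (lerD h1 h2).
Qed.

Lemma ball_algebra_affine (c : R[i]) (b : cvec R d) :
  ball_algebra (fun z => c + \sum_(i < d) b i * z i).
Proof.
split => z hz.
  exists b => e e0; exists 1 => // h _.
  have -> : \sum_(i < d) b i * vadd z h i =
      \sum_(i < d) b i * z i + \sum_(i < d) b i * h i.
    by rewrite -big_split /=; apply: eq_bigr => i _; rewrite /vadd mulrDr.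
  set S1 := \sum_(i < d) _; set S2 := \sum_(i < d) _.
  have -> : c + (S1 + S2) - (c + S1) - S2 = 0 by ring.
  by rewrite cabs0 mulr_ge0 ?vnorm_ge0 // ltW.
move=> e e0.
pose B := \sum_(i < d) cabs (b i).
have B0 : 0 <= B by apply: sumr_ge0 => i _; exact: cabs_ge0.
have B1 : 0 < B + 1 by rewrite ltr_wpDl.
exists (e / (B + 1)); first by rewrite divr_gt0.
move=> w hw; rewrite ltr_pdivlMr // => hd.
have -> : c + \sum_(i < d) b i * w i - (c + \sum_(i < d) b i * z i) =
    \sum_(i < d) b i * vsub w z i.
  rewrite opprD addrACA subrr add0r -sumrB.
  by apply: eq_bigr => i _; rewrite -mulrBr.
apply: le_lt_trans (cabs_sum _) _.
apply: le_lt_trans (_ : B * vnorm (vsub w z) < _).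
  rewrite mulr_suml; apply: ler_sum => i _; rewrite cabsM ler_wpM2l ?cabs_ge0 //.
  exact: cabs_le_vnorm.
have := vnorm_ge0 (vsub w z); lra.
Qed.

Lemma ball_algebra_scale (a : R[i]) f : ball_algebra f ->
  ball_algebra (fun z => a * f z).
Proof.
move=> hf; have := ball_algebra_lin a hf (ball_algebra_affine 0 (fun=> 0)).
congr ball_algebra; apply/funext => z.
by rewrite big1 => [|i _]; rewrite ?mul0r // !addr0.
Qed.

(** The factor 1/2 is distributed into the sum so that this is literally an instance of
    [ball_algebra_affine]. *)
Definition peak zeta z : R[i] :=
  2^-1 + \sum_(i < d) 2^-1 * conjc (zeta i) * z i.

Lemma sqr_cabsB (a b : R[i]) : cabs (a - b) ^+ 2 =
  cabs a ^+ 2 + cabs b ^+ 2 - 2 * complex.Re (conjc b * a).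
Proof. by case: a => a1 a2; case: b => b1 b2; rewrite !sqr_cabs /=; ring. Qed.

Lemma Re_sum n (F : 'I_n -> R[i]) :
  complex.Re (\sum_(i < n) F i) = \sum_(i < n) complex.Re (F i).
Proof. by apply: big_morph => // -[? ?] [? ?]. Qed.

Lemma sum_sqr_cabsB (a b : cvec R d) :
  \sum_(i < d) cabs (a i - b i) ^+ 2 =
  \sum_(i < d) cabs (a i) ^+ 2 + \sum_(i < d) cabs (b i) ^+ 2 -
  2 * complex.Re (\sum_(i < d) conjc (b i) * a i).
Proof.
rewrite Re_sum mulr_sumr -big_split /= -sumrB.
by apply: eq_bigr => i _; exact: sqr_cabsB.
Qed.

Lemma sum_sqr_unit_sphere zeta : unit_sphere zeta ->
  \sum_(i < d) cabs (zeta i) ^+ 2 = 1.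
Proof. by rewrite -sqr_vnorm => ->; rewrite expr1n. Qed.

(** With [w] the inner product of [z] and [zeta], expanding [|z - w zeta|^2 >= 0] gives
    [|w|^2 <= |z|^2]. *)
Lemma cauchy_schwarz_unit zeta z : unit_sphere zeta -> closed_ball z ->
  cabs (\sum_(i < d) conjc (zeta i) * z i) ^+ 2 <= 1.
Proof.
move=> /sum_sqr_unit_sphere hz /closed_ballP hb.
set w := \sum_(i < d) _.
have : 0 <= \sum_(i < d) cabs (z i - w * zeta i) ^+ 2.
  by apply: sumr_ge0 => i _; exact: sqr_ge0.
rewrite (sum_sqr_cabsB z (fun i => w * zeta i)).
have -> : \sum_(i < d) cabs (w * zeta i) ^+ 2 = cabs w ^+ 2.
  rewrite -[RHS]mulr1 -hz mulr_sumr; apply: eq_bigr => i _.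
  by rewrite cabsM exprMn.
have -> : \sum_(i < d) conjc (w * zeta i) * z i = (cabs w ^+ 2)%:C%C.
  rewrite -mulJc {2}/w mulr_sumr; apply: eq_bigr => i _.
  by rewrite rmorphM mulrA.
rewrite /=; lra.
Qed.

(** Since [|1 + w|^2 <= 2 + 2 Re w] and [|z - zeta|^2 <= 2 - 2 Re w], one gets
    [|1 + w|^2 <= 4 - |z - zeta|^2]. *)
Lemma cabs_peak zeta z : unit_sphere zeta -> closed_ball z ->
  cabs (peak zeta z) <= 1 - vnorm (vsub z zeta) ^+ 2 / 8.
Proof.
move=> hz hb; have cs := cauchy_schwarz_unit hz hb.
have := sum_sqr_cabsB z zeta; rewrite -sqr_vnorm (sum_sqr_unit_sphere hz).
move/closed_ballP: hb => hb; move: cs.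
have -> : peak zeta z = 2^-1 * (1 + \sum_(i < d) conjc (zeta i) * z i).
  rewrite /peak mulrDr mulr1 mulr_sumr; congr (_ + _).
  by apply: eq_bigr => i _; rewrite mulrA.
set w := \sum_(i < d) _ => cs.
set V := vnorm _ ^+ 2; set Z := \sum_(i < d) _ in hb * => VE.
have -> : cabs (2^-1 * (1 + w)) = cabs (1 + w) / 2.
  have -> : (2^-1 : R[i]) = (2^-1 : R)%:C%C by rewrite fmorphV rmorph_nat.
  by rewrite cabsM cabs_real ger0_norm ?invr_ge0 // mulrC.
have E : cabs (1 + w) ^+ 2 = 1 + 2 * complex.Re w + cabs w ^+ 2.
  by rewrite !sqr_cabs; case: (w) => w1 w2 /=; ring.
(* The inequality [4 x <= x^2 + 4] at [x = |1 + w|] removes the square and produces the constant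
   8. *)
have := sqr_ge0 (cabs (1 + w) - 2); rewrite sqrrB E; lra.
Qed.

Lemma peak_self zeta : unit_sphere zeta -> peak zeta zeta = 1.
Proof.
move=> /sum_sqr_unit_sphere hz; rewrite /peak.
have -> : \sum_(i < d) 2^-1 * conjc (zeta i) * zeta i =
    2^-1 * (\sum_(i < d) cabs (zeta i) ^+ 2)%:C%C.
  rewrite rmorph_sum mulr_sumr; apply: eq_bigr => i _.
  by rewrite -mulrA mulJc.
by rewrite hz rmorph1; field.
Qed.

Lemma dual_unit_ball_eval (zeta : cvec R d) (lam : R[i]) : closed_ball zeta ->
  cabs lam = 1 -> dual_unit_ball (fun f => lam * f zeta).
Proof.
move=> hz l1; split=> [a f g _ _|f [_ cf]]; first by ring.
by rewrite cabsM l1 mul1r cabs_le_supnorm.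
Qed.

(* If [p := psi h <> 0], then [e + s p^* h] would have norm at most
   [1 + s |p| (|p| / 2)] for small [s > 0], since [h] is small near [zeta] and
   [e] is bounded away from 1 elsewhere; but [psi] sends it to [1 + s |p|^2]. *)
Lemma functional_vanish_of_peak (psi : functional R d) (e h : cvec R d -> R[i]) zeta :
  dual_unit_ball psi -> ball_algebra e -> closed_ball zeta ->
  (forall z, closed_ball z -> cabs (e z) <= 1 - vnorm (vsub z zeta) ^+ 2 / 8) ->
  psi e = 1 -> ball_algebra h -> h zeta = 0 -> psi h = 0.
Proof.
move=> [lin bd] Ae hz he pe Ah h0.
set p := psi h; apply/eqP/negPn/negP => pn.
have p0 : 0 < cabs p.
  rewrite lt_neqAle cabs_ge0 andbT eq_sym; apply: contra pn => /eqP q.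
  by apply/eqP; exact: Normc.eq0_normc.
have eta0 : 0 < cabs p / 2 by rewrite divr_gt0.
have [_ ch] := Ah.
have [del del0 hd] := ch _ hz _ eta0.
pose H := supnorm h.
have H0 : 0 <= H := le_trans (cabs_ge0 _) (cabs_le_supnorm ch hz).
have D0 : 0 < del ^+ 2 / 8 by rewrite divr_gt0 // exprn_gt0.
have K0 : 0 < cabs p * (H + 1) by rewrite mulr_gt0 // ltr_wpDl.
(* Away from [zeta] the perturbation has size at most [s * cabs p * H], which is less than the gap
   [del^2 / 8] left by [e]. *)
pose s := del ^+ 2 / 8 / (cabs p * (H + 1)).
have s0 : 0 < s by rewrite divr_gt0.
have sE : s * (cabs p * (H + 1)) = del ^+ 2 / 8 by rewrite divfK ?gt_eqF.
pose a := s%:C%C * conjc p.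
have ca : cabs a = s * cabs p by rewrite cabsM cabsJ cabs_real ger0_norm ?ltW.
have := bd _ (ball_algebra_lin a Ah Ae).
rewrite lin // pe -/p.
have -> : a * p + 1 = (s * cabs p ^+ 2 + 1)%:C%C.
  by rewrite /a -mulrA mulJc -rmorphM rmorphD rmorph1.
rewrite cabs_real ger0_norm; last first.
  by rewrite addr_ge0 // mulr_ge0 ?sqr_ge0 // ltW.
have spp : 0 < s * cabs p ^+ 2 by rewrite mulr_gt0 // exprn_gt0.
suff : supnorm (fun z => a * h z + e z) <= s * cabs p ^+ 2 / 2 + 1 by lra.
apply: supnorm_le => z cz; apply: le_trans (cabsD _ _) _; rewrite cabsM ca.
have ez := he _ cz.
have [zd|zd] := ltP (vnorm (vsub z zeta)) del.
  have := hd _ cz zd; rewrite h0 subr0 => hz2.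
  have : s * cabs p * cabs (h z) <= s * cabs p * (cabs p / 2).
    by apply: ler_wpM2l (ltW hz2); rewrite mulr_ge0 ?cabs_ge0 // ltW.
  have := sqr_ge0 (vnorm (vsub z zeta)); lra.
have : del ^+ 2 <= vnorm (vsub z zeta) ^+ 2.
  by rewrite ler_pXn2r ?nnegrE ?vnorm_ge0 // ltW.
have : s * cabs p * cabs (h z) <= s * cabs p * H.
  apply: ler_wpM2l (cabs_le_supnorm ch cz).
  by rewrite mulr_ge0 ?cabs_ge0 // ltW.
have : 0 < s * cabs p by rewrite mulr_gt0.
lra.
Qed.

End BallAlgebraElements.

(** * The characterisation of the weak-star exposed points *)

Theorem theorem3p2 (R : realType) (d : nat) (hd : (1 <= d)%N)
    (phi : functional R d) :
  weak_star_exposed phi <->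
  exists (zeta : cvec R d) (lam : R[i]),
    unit_sphere zeta /\ cabs lam = 1 /\
    same_on_algebra phi (fun f => lam * f zeta).
Proof.
split.
  move=> [[_ bd] [e [Ae he]]].
  have [zeta hz eM] := supnorm_attained_sphere hd Ae.
  (* [lam] is the conjugate phase of [e zeta]. If that value is 0, then [supnorm e] is 0 and
     [lam = 1] works. *)
  have [lam l1 le] : exists2 lam : R[i], cabs lam = 1 &
      lam * e zeta = (supnorm e)%:C%C.
    have [e0|e0] := eqVneq (e zeta) 0.
      by exists 1; [exact: cabs1|rewrite -eM e0 cabs0 mulr0].
    have M0 : supnorm e != 0.
      by rewrite -eM; apply: contra e0 => /eqP /Normc.eq0_normc ->.
    exists ((supnorm e)^-1%:C%C * conjc (e zeta)).
      rewrite cabsM cabsJ cabs_real eM ger0_norm ?mulVf //.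
      by rewrite invr_ge0 -eM cabs_ge0.
    by rewrite -mulrA mulJc eM -rmorphM expr2 mulKf.
  have cz : closed_ball zeta by rewrite /closed_ball /= hz.
  exists zeta, lam; split=> //; split=> //.
  (* If the functionals differed, exposedness would give [supnorm e < Re (phi e)], contradicting the
     norm bound on [phi]. *)
  apply: contrapT => ns.
  have := he _ (dual_unit_ball_eval cz l1).
  rewrite le /= => /(_ (fun h => ns (fun f Af => esym (h f Af)))).
  by rewrite ltNge (le_trans (Re_le_cabs _)) // bd.
move=> [zeta [lam [hz [l1 hphi]]]].
have cz : closed_ball zeta by rewrite /closed_ball /= hz.
have ll : lam * conjc lam = 1 by rewrite mulrC mulJc l1 expr1n.
have [lin bd] := dual_unit_ball_eval cz l1.
split.
  split=> [a f g Af Ag|f Af]; last by rewrite hphi // bd.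
  by rewrite !hphi ?lin //; exact: ball_algebra_lin.
pose e z := conjc lam * peak zeta z.
have Ae : ball_algebra e by apply: ball_algebra_scale; exact: ball_algebra_affine.
have ce z : closed_ball z -> cabs (e z) <= 1 - vnorm (vsub z zeta) ^+ 2 / 8.
  by move=> hb; rewrite cabsM cabsJ l1 mul1r cabs_peak.
(* By contraposition, it suffices that [Re (psi e) >= 1], the value of [phi] on [e], forces [psi] to
   agree with [phi]. *)
exists e; split=> // psi hpsi; rewrite ltNge; apply: contra_notN.
rewrite hphi // /e peak_self // mulr1 ll /= => Re1.
(* A number in the closed unit disc with real part at least 1 equals 1. *)
have psie : psi e = 1.
  have p1 : cabs (psi e) <= 1.
    apply: le_trans (hpsi.2 _ Ae) _; apply: supnorm_le => z /ce /le_trans; apply.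
    by rewrite gerBl divr_ge0 // sqr_ge0.
  have : cabs (psi e) ^+ 2 <= 1 by rewrite expr_le1 // cabs_ge0.
  move: Re1 (sqr_cabs (psi e)); case: (psi e) => x y /= x1 -> xy.
  have x2 : 1 <= x ^+ 2 by rewrite expr_ge1 // (le_trans ler01).
  have y0 : y = 0.
    by apply/eqP; rewrite -sqrf_eq0 eq_le sqr_ge0 andbT; lra.
  have x0 : x = 1.
    have : x ^+ 2 <= 1 by have := sqr_ge0 y; lra.
    by rewrite expr_le1 ?(le_trans ler01) // => ?; apply/eqP; rewrite eq_le x1 andbT.
  by rewrite x0 y0.
move=> f Af; rewrite hphi //.
(* The function [f - lam * f zeta * e] vanishes at [zeta] because [e zeta = conjc lam]; since
   [psi e = 1], its being killed by [psi] says [psi f = lam * f zeta]. *)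
have Ah := ball_algebra_lin (- (lam * f zeta)) Ae Af.
have := functional_vanish_of_peak hpsi Ae cz ce psie Ah.
rewrite hpsi.1 // psie mulr1 /e peak_self // mulr1 => h.
apply/eqP; rewrite -subr_eq0 addrC; apply/eqP/h.
by rewrite mulNr mulrAC ll mul1r addNr.
Qed.
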